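(* The normal fan of the standard cut hypercube graph associahedron of the $n$-dimensional single path hypercube graph is linearly isomorphic to the linear $c$-cluster fan of type $A_n$, where $c=s_1s_2\cdots s_n$.
   Context: Let $\pm[n]=\{-n,\dots,-1,1,\dots,n\}$. The $n$-dimensional single path hypercube graph $G$ is the graph on $\pm[n]$ with edges $\{i,i+1\}$, $1\le i<n$, and no other edges. A tube of $G$ is a nonempty subset of $\pm[n]$ inducing a connected subgraph and containing no pair $\{i,-i\}$. Two tubes are weakly compatible if one is contained in the other, or they are disjoint with no edge between them. A tubing is a set $T$ of pairwise weakly compatible tubes whose union contains no pair $\{i,-i\}$. A hypercube graph associahedron of $G$ is a simple $n$-dimensional polytope whose dual simplicial complex (sets of facets with nonempty intersection) is isomorphic to the complex of tubings. With $e_{-i}=-e_i\in\mathbb{R}^n$, it is a standard cut one if its normal fan equals the fan of all cones $K_T=\operatorname{Cone}\{\sum_{i\in t}e_i\mid t\in T\}$, $T$ a tubing, where $\operatorname{Cone}$ denotes the set of nonnegative linear combinations. The type $A_n$ root system consists of the vectors $\epsilon_i-\epsilon_j$, $i\neq j$ in $[n+1]$, where $\epsilon_1,\dots,\epsilon_{n+1}$ is the standard basis of $\mathbb{R}^{n+1}$. Its simple roots are $\alpha_i=\epsilon_i-\epsilon_{i+1}$, and $s_i$ is the transposition $(i\;\,i+1)$ acting by permuting coordinates, $1\le i\le n$. An almost positive root is a root that is a nonnegative combination of simple roots or is equal to $-\alpha_i$ for some $i$. The fan below lives in the span of the roots. Let $[\beta:\alpha_i]$ be the coefficient of $\alpha_i$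 in $\beta$ written in simple roots. Define $\sigma_i(\beta)=\beta$ if $\beta=-\alpha_j$ with $j\ne i$, and $\sigma_i(\beta)=s_i\beta$ otherwise. A Coxeter element is a product of $s_1,\dots,s_n$, each once, in some order; $s_i$ is initial in $c$ if some reduced word for $c$ starts with $s_i$. The $c$-compatibility relations $\|_c$ (one symmetric relation on almost positive roots for each Coxeter element $c$) form the unique family such that (1) $-\alpha_i\,\|_c\,\beta$ iff $[\beta:\alpha_i]=0$ (for $\beta\neq-\alpha_i$); (2) if $s_i$ is initial in $c$, then $\beta_1\|_c\beta_2$ iff $\sigma_i(\beta_1)\,\|_{s_ics_i}\,\sigma_i(\beta_2)$. The $c$-cluster fan consists of the cones $\operatorname{Cone}\{\beta_1,\dots,\beta_k\}$ for all sets of pairwise $\|_c$-compatible almost positive roots. The linear $c$-cluster fan is the one for the linear Coxeter element $c=s_1s_2\cdots s_n$. *)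

(* Defs.v *)
From HB Require Import structures.
From mathcomp Require Import all_boot all_order all_algebra all_fingroup.
From mathcomp Require Import boolp classical_sets functions cardinality reals.

Set Implicit Arguments.
Unset Strict Implicit.
Unset Printing Implicit Defensive.

Import Order.TTheory GRing.Theory Num.Theory.
Local Open Scope classical_set_scope.
Local Open Scope ring_scope.

Definition Cone (R : realType) (V : lmodType R) (S : set V) : set V :=
  [set v | exists k (x : 'I_k -> V) (a : 'I_k -> R),
     (forall i, S (x i) /\ 0 <= a i) /\ v = \sum_(i < k) a i *: x i].

(* A fan is represented by the set of its cones. *)
Definition linearly_isomorphic_fans (R : realType) (vT wT : vectType R)
    (U : {vspace vT}) (W : {vspace wT})
    (Phi : set (set vT)) (Psi : set (set wT)) : Prop :=
  exists f : 'Hom(vT, wT),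
    [/\ {in U &, injective f}, (f @: U)%VS = W &
        [set [set f x | x in K] | K in Phi] = Psi].

Section Polytopes.
Variables (R : realType) (n : nat).
Local Notation V := 'rV[R]_n.

Definition dot (w x : V) : R := \sum_(i < n) w 0 i * x 0 i.

Definition convex_hull (k : nat) (x : 'I_k -> V) : set V :=
  [set v | exists a : 'I_k -> R,
     [/\ forall i, 0 <= a i, \sum_(i < k) a i = 1 &
         v = \sum_(i < k) a i *: x i]].

Definition polytope (P : set V) : Prop :=
  exists k (x : 'I_k.+1 -> V), P = convex_hull x.

(* The nonempty faces of P, including P itself (w = 0). *)
Definition face (P F : set V) : Prop :=
  F !=set0 /\
  exists w, F = [set x | P x /\ forall y, P y -> dot w y <= dot w x].

(* U is the direction of the affine hull of the nonempty set A. *)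
Definition direction (A : set V) (U : {vspace V}) : Prop :=
  (forall x y, A x -> A y -> x - y \in U) /\
  (forall W : {vspace V},
     (forall x y, A x -> A y -> x - y \in W) -> (U <= W)%VS).

Definition has_dim (A : set V) (d : nat) : Prop :=
  A !=set0 /\ exists2 U, direction A U & \dim U = d.

Definition vertex (P : set V) (x : V) : Prop := face P [set x].

Definition facet (P F : set V) : Prop :=
  face P F /\ exists2 d, has_dim F d & has_dim P d.+1.

Definition simple_polytope (P : set V) (d : nat) : Prop :=
  [/\ polytope P, has_dim P d &
      forall x, vertex P x -> ([set F | facet P F /\ F x] #= `I_d)%card].

Definition dual_complex (P : set V) : set (set (set V)) :=
  [set S | S `<=` facet P /\ (P `&` \bigcap_(F in S) F) !=set0].

(* Outer normal cone of P along F. *)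
Definition normal_cone (P F : set V) : set V :=
  [set w | forall x y, F x -> P y -> dot w y <= dot w x].

Definition normal_fan (P : set V) : set (set V) :=
  [set normal_cone P F | F in face P].

End Polytopes.

(* A simplicial complex is given by its set of simplices. *)

Definition complex_vertices (A : Type) (D : set (set A)) : set A :=
  [set a | D [set a]].

Definition complex_isomorphic (A B : Type) (D : set (set A)) (E : set (set B)) :
    Prop :=
  exists f : A -> B,
    set_bij (complex_vertices D) (complex_vertices E) f /\
    forall S, S `<=` complex_vertices D -> (D S <-> E [set f a | a in S]).

(* For 0 <= i < n, (i, true) stands for i + 1 and (i, false) for -(i + 1). *)
Notation pm n := (('I_n * bool)%type) (only parsing).

Definition pm_opp (n : nat) (u : pm n) : pm n := (u.1, ~~ u.2).

Definition pm_vec (R : realType) (n : nat) (u : pm n) : 'rV[R]_n :=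
  if u.2 then delta_mx 0 u.1 else - delta_mx 0 u.1.

Definition single_path (n : nat) : rel (pm n) :=
  [rel u v : pm n | [&& u.2, v.2 &
      (u.1.+1 == v.1 :> nat) || (v.1.+1 == u.1 :> nat)]].

Section Tubings.
Variables (n : nat) (e : rel (pm n)).

Definition tube (t : {set pm n}) : bool :=
  [&& t != finset.set0,
      [forall x in t, forall y in t,
         connect [rel u v : pm n | [&& u \in t, v \in t & e u v]] x y] &
      [forall x in t, pm_opp x \notin t]].

Definition weakly_compatible (s t : {set pm n}) : bool :=
  [|| s \subset t, t \subset s |
      [disjoint s & t] && [forall x in s, forall y in t, ~~ e x y]].

Definition tubing (T : set {set pm n}) : Prop :=
  [/\ forall t, T t -> tube t,
      forall s t, T s -> T t -> weakly_compatible s t &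
      forall s t x, T s -> T t -> x \in s -> pm_opp x \notin t].

Definition tube_vec (R : realType) (t : {set pm n}) : 'rV[R]_n :=
  \sum_(u in t) pm_vec R u.

Definition tubing_fan (R : realType) : set (set 'rV[R]_n) :=
  [set Cone [set tube_vec R t | t in T] | T in tubing].

Definition hypercube_graph_associahedron (R : realType) (P : set 'rV[R]_n) :
    Prop :=
  simple_polytope P n /\ complex_isomorphic (dual_complex P) tubing.

Definition standard_cut (R : realType) (P : set 'rV[R]_n) : Prop :=
  hypercube_graph_associahedron P /\ normal_fan P = @tubing_fan R.

End Tubings.

(* Indices 0 <= i < n stand for 1, ..., n *)

Section CoxeterGroup.
Variable n : nat.

Definition simple_refl (i : 'I_n) : {perm 'I_n.+1} :=
  tperm (widen_ord (leqnSn n) i) (lift ord0 i).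

Definition word_prod (w : seq 'I_n) : {perm 'I_n.+1} :=
  (\prod_(i <- w) simple_refl i)%g.

Definition reduced_word (c : {perm 'I_n.+1}) (w : seq 'I_n) : Prop :=
  word_prod w = c /\ forall v, word_prod v = c -> (size w <= size v)%N.

Definition coxeter_element (c : {perm 'I_n.+1}) : Prop :=
  exists2 w, perm_eq w (enum 'I_n) & c = word_prod w.

Definition initial (i : 'I_n) (c : {perm 'I_n.+1}) : Prop :=
  exists w, reduced_word c (i :: w).

Definition linear_coxeter : {perm 'I_n.+1} := word_prod (enum 'I_n).

End CoxeterGroup.
Arguments linear_coxeter n : clear implicits.

Section ClusterFan.
Variables (R : realType) (n : nat).
Local Notation V := 'rV[R]_n.+1.

Definition eps (i : 'I_n.+1) : V := delta_mx 0 i.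

Definition roots : seq V :=
  [seq eps p.1 - eps p.2 | p <- enum {: 'I_n.+1 * 'I_n.+1} & p.1 != p.2].

Definition root_space : {vspace V} := <<roots>>%VS.

Definition simple_root (i : 'I_n) : V :=
  eps (widen_ord (leqnSn n) i) - eps (lift ord0 i).

Definition almost_positive (b : V) : Prop :=
  b \in roots /\
  ((exists2 a : 'I_n -> R, (forall i, 0 <= a i) &
      b = \sum_(i < n) a i *: simple_root i)
   \/ exists i, b = - simple_root i).

(* The coefficient [b : alpha_i]. *)
Definition simple_coef (b : V) (i : 'I_n) : R :=
  coord [tuple simple_root j | j < n] i b.

Definition refl_act (i : 'I_n) (b : V) : V := col_perm (simple_refl i) b.

Definition sigma (i : 'I_n) (b : V) : V :=
  if [exists j, (j != i) && (b == - simple_root j)] then b else refl_act i b.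

(* The diagonal b1 = b2 is not determined by these axioms; accordingly only
   distinct roots are compared in [cluster_fan]. Values of [compat] outside
   Coxeter elements and almost positive roots are irrelevant. *)
Definition c_compatibility (compat : {perm 'I_n.+1} -> V -> V -> Prop) : Prop :=
  forall c, coxeter_element c ->
  [/\ forall b1 b2, almost_positive b1 -> almost_positive b2 ->
        compat c b1 b2 -> compat c b2 b1,
      forall i b, almost_positive b -> b <> - simple_root i ->
        (compat c (- simple_root i) b <-> simple_coef b i = 0) &
      forall i, initial i c ->
        forall b1 b2, almost_positive b1 -> almost_positive b2 ->
        (compat c b1 b2 <->
         compat (simple_refl i * c * simple_refl i)%g (sigma i b1) (sigma i b2))].

Definition cluster_fan (compat : V -> V -> Prop) : set (set V) :=
  [set Cone S | S in [set S : set V | S `<=` almost_positive /\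
     forall b1 b2, S b1 -> S b2 -> b1 <> b2 -> compat b1 b2]].

End ClusterFan.

(* Main.v *)
(* The linear map sending e_i to the simple root alpha_i works. The tubes of the
   single path are the positive intervals {x+1, ..., y} and the singletons {-i};
   their vectors go to the positive roots eps_x - eps_y (coordinates numbered
   from 0) and to the negative simple roots -alpha_i, so it remains to see that
   c-compatibility of roots is compatibility of tubes. Pairs with a negative
   simple root are handled by axiom (1). For positive roots eps_x - eps_y and
   eps_x' - eps_y', applying sigma for s_1, ..., s_n in turn brings the linear
   Coxeter element back to itself and, if x and x' are positive, lowers all four
   indices by one; so one may assume x = 0. Then applying sigma for the first y
   reflections turns eps_0 - eps_y into a negative simple root, and axiom (1)
   applies again. *)
Require Import Defs.
From HB Require Import structures.
From mathcomp Require Import all_boot all_order all_algebra all_fingroup.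
From mathcomp Require Import boolp classical_sets functions cardinality reals.
From mathcomp Require Import zify.

Set Implicit Arguments.
Unset Strict Implicit.
Unset Printing Implicit Defensive.

Import Order.TTheory GRing.Theory Num.Theory.
Local Open Scope classical_set_scope.
Local Open Scope ring_scope.

(** * Positive and almost positive roots *)

Section Roots.
Variables (R : realType) (n : nat).
Local Notation V := 'rV[R]_n.+1.
Local Notation alpha := (@simple_root R n).

(** Indices are natural numbers, so that shifts and swaps become plain arithmetic; since [inord]
    sends everything above [n] to 0, the value is meaningful only for [x, y <= n]. *)
Definition eps_diff (x y : nat) : V := eps R (inord x : 'I_n.+1) - eps R (inord y).

Definition simple_mx : 'M[R]_(n, n.+1) := \matrix_(i < n) alpha i.

(** Right multiplication takes a vector to the sums of its coordinates 0, ..., i. On the span of the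
    simple roots these sums are the coefficients in the simple roots, and [eps_diff x y] with
    [x <= y] yields the indicator of [x, y). *)
Definition partial_sums_mx : 'M[R]_(n.+1, n) := \matrix_(k, i) (k <= i)%N%:R.

Lemma simple_rootE (i : 'I_n) : alpha i = eps_diff i i.+1.
Proof.
rewrite /simple_root /eps_diff; congr (eps R _ - eps R _); apply: val_inj => /=.
  by rewrite inordK //; have := ltn_ord i; lia.
by rewrite inordK ?ltnS // ltn_ord.
Qed.

Lemma eps_partial_sums (k : 'I_n.+1) (i : 'I_n) :
  (eps R k *m partial_sums_mx) 0 i = (k <= i)%N%:R.
Proof. by rewrite /eps -rowE !mxE. Qed.

Lemma eps_diff_partial_sums (x y : nat) (i : 'I_n) : (x <= n)%N -> (y <= n)%N ->
  (eps_diff x y *m partial_sums_mx) 0 i = (x <= i)%N%:R - (y <= i)%N%:R.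
Proof.
move=> xn yn; rewrite /eps_diff mulmxBl [LHS]mxE eps_partial_sums [X in _ + X]mxE.
by rewrite eps_partial_sums !inordK.
Qed.

Lemma simple_mxK : simple_mx *m partial_sums_mx = 1%:M.
Proof.
apply/row_matrixP => i; rewrite row_mul rowK; apply/rowP => j.
rewrite simple_rootE eps_diff_partial_sums ?(ltnW (ltn_ord i)) ?(ltn_ord i) // !mxE.
have [ij|ij|/val_inj->] := ltngtP i j; last 1 first.
- by rewrite eqxx subr0.
- by rewrite subrr; case: eqP ij => // ->; rewrite ltnn.
- by rewrite subrr; case: eqP ij => // ->; rewrite ltnn.
Qed.

Lemma mul_simple_mx (v : 'rV_n) : v *m simple_mx = \sum_i v 0 i *: alpha i.
Proof. by rewrite mulmx_sum_row; apply: eq_bigr => i _; rewrite rowK. Qed.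

Lemma comb_simple (a : 'I_n -> R) :
  \sum_i a i *: alpha i = (\row_i a i) *m simple_mx.
Proof. by rewrite mul_simple_mx; apply: eq_bigr => i _; rewrite mxE. Qed.

Lemma eps_diff_sum (x y : nat) : (x <= y <= n)%N ->
  eps_diff x y = \sum_(i < n) (x <= i < y)%N%:R *: alpha i.
Proof.
case/andP => xy yn.
(* The sign makes the increment [F k.+1 - F k] equal to the simple root of index k, so the sum
   telescopes. *)
pose F k : V := - eps R (inord k).
have -> : eps_diff x y = F y - F x by rewrite /F opprK addrC.
rewrite -(telescope_sumr F xy).
rewrite (big_nat_widen _ _ _ _ _ yn) (big_nat_widenl _ 0%N) //= big_mkord.
rewrite big_mkcond; apply: eq_bigr => i _; rewrite simple_rootE /eps_diff /F /=.
by rewrite [X in if X then _ else _]andbC; case: ifP => _;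
  rewrite ?scale1r ?scale0r // opprK addrC.
Qed.

Lemma eps_diff_inj (x y x' y' : nat) : (x < y <= n)%N -> (x' < y' <= n)%N ->
  eps_diff x y = eps_diff x' y' -> x = x' /\ y = y'.
Proof.
move=> /andP[xy yn] /andP[xy' yn'] e.
have {e}E i : (i < n)%N -> (x <= i < y)%N = (x' <= i < y')%N.
  move=> ni; have := congr1 (fun v => (v *m partial_sums_mx) 0 (Ordinal ni)) e.
  rewrite !eps_diff_partial_sums; try lia.
  move=> /= e1; apply/idP/idP => h; apply: contraT => h'; exfalso; move: e1.
    have -> : (x <= i)%N = true by lia.
    have -> : (y <= i)%N = false by lia.
    have -> : (x' <= i)%N = (y' <= i)%N by lia.
    by rewrite subrr subr0 => /eqP; rewrite oner_eq0.
  have -> : (x' <= i)%N = true by lia.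
  have -> : (y' <= i)%N = false by lia.
  have -> : (x <= i)%N = (y <= i)%N by lia.
  by rewrite subrr subr0 => /eqP; rewrite eq_sym oner_eq0.
(* Nonempty intervals with the same elements coincide; testing the first and last element of each is
   enough. *)
have := E x; have := E y.-1; have := E x'; have := E y'.-1.
lia.
Qed.

(** The i-th partial sum is nonnegative on the left and -1 on the right. *)
Lemma eps_diff_neq_opp_simple (x y : nat) (i : 'I_n) : (x < y <= n)%N ->
  eps_diff x y <> - alpha i.
Proof.
case/andP=> xy yn /(congr1 (fun v => (v *m partial_sums_mx) 0 i)).
rewrite eps_diff_partial_sums //; last by lia.
rewrite mulNmx mxE simple_rootE.
rewrite eps_diff_partial_sums ?(ltnW (ltn_ord i)) ?(ltn_ord i) //.
rewrite leqnn ltnn subr0 => e.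
have : (0 : R) <= -1.
  rewrite -e; case: (leqP y i) => [yi|_]; last by rewrite subr0.
  by rewrite (_ : (x <= i)%N) ?subrr //; lia.
by rewrite oppr_ge0 ler10.
Qed.

Lemma opp_simple_inj : injective (fun i => - alpha i).
Proof.
move=> i j /oppr_inj; rewrite !simple_rootE => /eps_diff_inj [||/val_inj //].
  by rewrite ltnS leqnn ltn_ord.
by rewrite ltnS leqnn ltn_ord.
Qed.

Lemma eps_diff_in_roots (x y : nat) : (x <= n)%N -> (y <= n)%N -> x != y ->
  eps_diff x y \in Defs.roots R n.
Proof.
move=> xn yn xy; apply/mapP.
exists (inord x, inord y); last by [].
rewrite mem_filter mem_enum andbT /=; apply: contraNneq xy => /(congr1 val).
by rewrite /= !inordK // => ->.
Qed.

Lemma almost_positive_eps_diff (x y : nat) : (x < y <= n)%N ->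
  almost_positive (eps_diff x y).
Proof.
move=> xyn; split; first by apply: eps_diff_in_roots; lia.
left; exists (fun i : 'I_n => (x <= i < y)%N%:R) => [i|]; first exact: ler0n.
by apply: eps_diff_sum; lia.
Qed.

Lemma almost_positive_opp_simple (i : 'I_n) : almost_positive (- alpha i).
Proof.
split; last by right; exists i.
rewrite simple_rootE /eps_diff opprB; have := ltn_ord i.
by move=> lin; apply: (@eps_diff_in_roots i.+1 i); lia.
Qed.

Lemma almost_positiveE (b : V) : almost_positive b ->
  (exists x y, (x < y <= n)%N /\ b = eps_diff x y) \/ exists i, b = - alpha i.
Proof.
case=> + [[a a_ge0 bE]|]; last by right.
case/mapP=> -[x y]; rewrite mem_filter /= => /andP[xy _] e; left.
have bxy : b = eps_diff x y by rewrite e /eps_diff !inord_val.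
exists x, y; split=> //; move: (ltn_ord y); rewrite ltnS => yn.
rewrite yn andbT ltnNge leq_eqVlt; apply/negP => /orP[/eqP/val_inj yx|yx].
  by rewrite yx eqxx in xy.
(* If [y < x], the y-th partial sum of the root is -1, yet it equals the nonnegative coefficient
   [a y]. *)
have ny : (y < n)%N by rewrite (leq_trans yx) // -ltnS.
have := a_ge0 (Ordinal ny).
have -> : a (Ordinal ny) = (b *m partial_sums_mx) 0 (Ordinal ny).
  by rewrite bE comb_simple -mulmxA simple_mxK mulmx1 mxE.
have xn : (x <= n)%N by rewrite -ltnS.
rewrite bxy eps_diff_partial_sums //= leqnn (leqNgt x) yx sub0r.
by rewrite oppr_ge0 ler10.
Qed.

Lemma simple_free : free [tuple alpha j | j < n].
Proof.
apply/freeP => k; under eq_bigr => i _ do rewrite -tnth_nth tnth_mktuple.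
rewrite comb_simple => /(congr1 (fun v => v *m partial_sums_mx)).
by rewrite -mulmxA simple_mxK mulmx1 mul0mx => /rowP k0 i; have := k0 i; rewrite !mxE.
Qed.

Lemma simple_coef_comb (a : 'I_n -> R) (i : 'I_n) :
  simple_coef (\sum_j a j *: alpha j) i = a i.
Proof.
rewrite /simple_coef -(coord_sum_free a i simple_free).
by congr (coord _ _ _); apply: eq_bigr => j _; rewrite -tnth_nth tnth_mktuple.
Qed.

Lemma simple_coef_eps_diff (x y : nat) (i : 'I_n) : (x <= y <= n)%N ->
  simple_coef (eps_diff x y) i = (x <= i < y)%N%:R.
Proof. by move=> xyn; rewrite eps_diff_sum // simple_coef_comb. Qed.

Lemma simple_coef_opp_simple (i j : 'I_n) :
  j != i -> simple_coef (- alpha j) i = 0.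
Proof.
move=> ji; rewrite /simple_coef linearN /= -/(simple_coef _ _) simple_rootE.
rewrite simple_coef_eps_diff; last by rewrite leqnSn ltn_ord.
case: (_ <= _ < _)%N / boolP => h; rewrite ?oppr0 //.
by case/eqP: ji; apply: val_inj => /=; lia.
Qed.

Definition swap (i k : nat) : nat :=
  if k == i then i.+1 else if k == i.+1 then i else k.

Lemma simple_refl_inord (i : 'I_n) (k : nat) : (k <= n)%N ->
  simple_refl i (inord k) = inord (swap i k).
Proof.
move=> kn; have := ltn_ord i => lin.
have iE : widen_ord (leqnSn n) i = inord i.
  by apply: val_inj => /=; rewrite inordK //; lia.
have jE : lift ord0 i = inord i.+1 by apply: val_inj => /=; rewrite inordK ?ltnS.
rewrite /simple_refl /swap iE jE permE /= -!val_eqE /= !inordK //; last lia.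
by do 2?case: ifP.
Qed.

Lemma refl_act_eps_diff (i : 'I_n) (x y : nat) : (x <= n)%N -> (y <= n)%N ->
  refl_act i (eps_diff x y) = eps_diff (swap i x) (swap i y).
Proof.
have E k : (k <= n)%N ->
    col_perm (simple_refl i) (eps R (inord k)) = eps R (inord (swap i k)).
  move=> kn; apply/rowP => j; rewrite !mxE -simple_refl_inord // !eqxx /=.
  by congr (nat_of_bool _)%:R; apply/eqP/eqP => [<-|->]; rewrite /simple_refl tpermK.
by move=> xn yn; rewrite /refl_act /eps_diff linearB /= !E.
Qed.

Lemma sigma_eps_diff (i : 'I_n) (x y : nat) : (x < y <= n)%N ->
  sigma i (eps_diff x y) = eps_diff (swap i x) (swap i y).
Proof.
move=> xyn; rewrite /sigma ifF; first by apply: refl_act_eps_diff; lia.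
by apply/existsP => -[j /andP[_ /eqP /(eps_diff_neq_opp_simple xyn)]].
Qed.

End Roots.

(** * Compatibility of roots for the linear Coxeter element *)

Section CoxeterWords.
Variable n : nat.
Implicit Types (i j : 'I_n) (w v : seq 'I_n).

Lemma word_prod_cat w v : word_prod (w ++ v) = (word_prod w * word_prod v)%g.
Proof. exact: big_cat. Qed.

Lemma word_prod_cons i w : word_prod (i :: w) = (simple_refl i * word_prod w)%g.
Proof. exact: big_cons. Qed.

Lemma simple_refl_le i j (k : 'I_n.+1) :
  j != i -> (simple_refl j k <= i)%N = (k <= i)%N.
Proof.
move=> ji; have kn : (k <= n)%N by rewrite -ltnS.
have := ltn_ord i; have := ltn_ord j => ln lin.
have {}ji : nat_of_ord j <> i by move=> /val_inj e; rewrite e eqxx in ji.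
rewrite -[k]inord_val simple_refl_inord //= !inordK //; last first.
  by rewrite /swap; do 2?case: ifP; lia.
rewrite /swap; case: ifP => [/eqP ->|_]; first by lia.
by case: ifP => [/eqP ->|_] //; lia.
Qed.

Lemma word_prod_le i w (k : 'I_n.+1) :
  i \notin w -> (word_prod w k <= i)%N = (k <= i)%N.
Proof.
elim: w k => [|j w IHw] k; first by rewrite /word_prod big_nil perm1.
rewrite inE negb_or eq_sym => /andP[ji iw].
by rewrite word_prod_cons permM IHw // simple_refl_le.
Qed.

(* A product of simple reflections avoiding s_i stabilizes {0, ..., i}, whereas
   one with a single s_i does not; so every word for a Coxeter element uses all
   the simple reflections. *)
Lemma coxeter_reduced_word w :
  perm_eq w (enum 'I_n) -> reduced_word (word_prod w) w.
Proof.
move=> wE; split=> // v vw; have uw : uniq w.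
  by rewrite (perm_uniq wE) enum_uniq.
apply: uniq_leq_size => // i iw; apply: contraT => iv.
case/splitPr: iw vw uw => w1 w2 vw.
rewrite cat_uniq => /and3P[_ /hasPn h /= /andP[iw2 _]].
have iw1 : i \notin w1 by have := h i; rewrite inE eqxx /=; apply.
(* The product acts from the left: [w1] takes k to i, the reflection at i takes i to i + 1, and [w2]
   cannot bring it back below. So k leaves {0, ..., i}, which [v] would forbid. *)
pose k := ((word_prod w1)^-1 (inord i))%g.
have lin := ltn_ord i.
have ik : (k <= i)%N.
  by rewrite -(word_prod_le _ iw1) permKV inordK // ltnS ltnW.
have := word_prod_le k iv; rewrite ik vw word_prod_cat word_prod_cons !permM.
rewrite permKV word_prod_le // simple_refl_inord ?(ltnW lin) //.
by rewrite /swap eqxx inordK // ltnn.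
Qed.

Lemma coxeter_initial i w : perm_eq (i :: w) (enum 'I_n) ->
  initial i (word_prod (i :: w)).
Proof. by move=> wE; exists w; apply: coxeter_reduced_word. Qed.

Lemma simple_reflK i : (simple_refl i * simple_refl i)%g = 1%g.
Proof. exact: tperm2. Qed.

(** This turns the conjugation in axiom (2) into a rotation of the word. *)
Lemma coxeter_conj i w :
  (simple_refl i * word_prod (i :: w) * simple_refl i)%g = word_prod (rcons w i).
Proof.
rewrite -cats1 word_prod_cat !word_prod_cons !mulgA simple_reflK mul1g.
by rewrite /word_prod big_nil mulg1.
Qed.

End CoxeterWords.

(* The position in which [x] ends after the transpositions (0 1), (1 2), ...,
   (m-1 m) are applied in turn. *)
Definition sweep (m x : nat) : nat :=
  if x == 0%N then m else if (x <= m)%N then x.-1 else x.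

Lemma sweepP m x : [\/ x = 0%N /\ sweep m x = m,
  0 < x <= m /\ sweep m x = x.-1 | m < x /\ sweep m x = x]%N.
Proof.
rewrite /sweep; case: (x =P 0%N) => [->|x0]; first exact: Or31.
by case: (leqP x m) => xm; [apply: Or32 | apply: Or33]; split; lia.
Qed.

Lemma sweepS m x : swap m (sweep m x) = sweep m.+1 x.
Proof.
rewrite /swap; case: (sweepP m x); case: (sweepP m.+1 x);
by case: eqP => ?; try case: eqP => ?; lia.
Qed.

(* The intervals [x, y) and [x', y') are nested, or disjoint and not adjacent. *)
Definition noncrossing (x y x' y' : nat) : bool :=
  [|| (x' <= x) && (y <= y'), (x <= x') && (y' <= y), y < x' | y' < x]%N.

(** * Compatibility of positive roots as noncrossing of intervals *)

Section Compatibility.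
Variables (R : realType) (n : nat).
Local Notation V := 'rV[R]_n.+1.
Variable compat : {perm 'I_n.+1} -> V -> V -> Prop.
Hypothesis hcompat : c_compatibility compat.
Local Notation alpha := (@simple_root R n).
Local Notation D := (@eps_diff R n).
Local Notation rotated m := (word_prod (rot m (enum 'I_n))).

Lemma rotated_coxeter m : coxeter_element (rotated m).
Proof. by exists (rot m (enum 'I_n)); rewrite // perm_rot. Qed.

(** The word [rot i (enum 'I_n)] begins with the letter i, which is therefore initial, and axiom (2)
    moves on to the next rotation. *)
Lemma compat_step (i : 'I_n) (b1 b2 : V) :
  almost_positive b1 -> almost_positive b2 ->
  compat (rotated i) b1 b2 <-> compat (rotated i.+1) (sigma i b1) (sigma i b2).
Proof.
move=> b1P b2P.
have si : (i < size (enum 'I_n))%N by rewrite size_enum_ord.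
have e : rot i (enum 'I_n) = i :: behead (rot i (enum 'I_n)).
  by rewrite /rot (drop_nth i si) nth_ord_enum.
have [_ _ /(_ i)] := hcompat (rotated_coxeter i).
rewrite e => h; rewrite rotS // e rot1_cons -coxeter_conj; apply: h => //.
by apply: coxeter_initial; rewrite -e perm_rot.
Qed.

(** The last two hypotheses keep both roots positive before each of the m reflections, so that
    [sigma] always acts by the reflection itself. Only the last reflection may produce a negative
    root, namely when [x = 0] and [y = m]. *)
Lemma compat_sweep (m x y x' y' : nat) :
  (m <= n)%N -> (x < y <= n)%N -> (x' < y' <= n)%N ->
  (0 < x)%N || (m <= y)%N -> (0 < x')%N || (m <= y')%N ->
  compat (linear_coxeter n) (D x y) (D x' y') <->
  compat (rotated m) (D (sweep m x) (sweep m y)) (D (sweep m x') (sweep m y')).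
Proof.
move=> mn xy xy'; elim: m mn => [_ _ _|m IHm mn xm xm'].
  have s0 z : sweep 0 z = z by rewrite /sweep leqn0; case: eqP.
  by rewrite rot0 !s0.
apply: (iff_trans (IHm _ _ _)); try lia.
have ok a b : (a < b <= n)%N -> (0 < a)%N || (m.+1 <= b)%N ->
    (sweep m a < sweep m b <= n)%N.
  by move=> ab am; case: (sweepP m a); case: (sweepP m b); lia.
have /(ok _ _ xy) xyP := xm; have /(ok _ _ xy') xyP' := xm'.
apply: (iff_trans (compat_step (Ordinal mn) _ _)); try exact: almost_positive_eps_diff.
by rewrite !sigma_eps_diff //= !sweepS.
Qed.

(** After a full sweep, [m = n], the word has rotated back to itself and every positive index has
    dropped by one. *)
Lemma compat_shift (x y x' y' : nat) : (x < y < n)%N -> (x' < y' < n)%N ->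
  compat (linear_coxeter n) (D x.+1 y.+1) (D x'.+1 y'.+1) <->
  compat (linear_coxeter n) (D x y) (D x' y').
Proof.
move=> xy xy'; apply: (iff_trans (@compat_sweep n _ _ _ _ _ _ _ _ _)); try lia.
rewrite /sweep /= !ifT; try lia.
by rewrite rot_oversize ?size_enum_ord.
Qed.

(** The sweep of length [y] ends with the first root negative simple, where axiom (1) decides. The
    last hypothesis ensures that the second root is still positive then. *)
Lemma compat_origin (y x' y' : nat) : (0 < y <= n)%N -> (x' < y' <= n)%N ->
  (0 < x')%N || (y < y')%N ->
  compat (linear_coxeter n) (D 0%N y) (D x' y') <-> noncrossing 0%N y x' y'.
Proof.
case: y => // y yn xy' h.
apply: (iff_trans (@compat_sweep y.+1 _ _ _ _ _ _ _ _ _)); try lia.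
have {1}-> : sweep y.+1 0%N = y.+1 by [].
have {1}-> : sweep y.+1 y.+1 = y by rewrite /sweep /= leqnn.
have lyn : (y < n)%N by lia.
have -> : D y.+1 y = - alpha (Ordinal lyn).
  by rewrite simple_rootE /= /eps_diff opprB.
have sP : (sweep y.+1 x' < sweep y.+1 y' <= n)%N.
  by case: (sweepP y.+1 x'); case: (sweepP y.+1 y'); lia.
have [_ + _] := hcompat (rotated_coxeter y.+1).
move=> /(_ (Ordinal lyn) _
  (almost_positive_eps_diff R sP) (eps_diff_neq_opp_simple sP)).
move=> h'; apply: (iff_trans h'); rewrite simple_coef_eps_diff /=; last by lia.
(* Here [y.+1] is the original endpoint. The swept second interval contains [y] exactly when the
   original one crosses [0, y + 1) or begins right at its end. *)
set b := (X in (nat_of_bool X)%:R); have -> : noncrossing 0%N y.+1 x' y' = ~~ b.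
  rewrite /b /noncrossing; case: (sweepP y.+1 x'); case: (sweepP y.+1 y'); lia.
by case: b; split=> // /eqP; rewrite oner_eq0.
Qed.

Lemma compat_sym (b1 b2 : V) : almost_positive b1 -> almost_positive b2 ->
  compat (linear_coxeter n) b1 b2 <-> compat (linear_coxeter n) b2 b1.
Proof.
move=> b1P b2P; have [s _ _] := hcompat (rotated_coxeter 0).
by rewrite rot0 in s; split; apply: s.
Qed.

Lemma compat_eps_diff (x y x' y' : nat) :
  (x < y <= n)%N -> (x' < y' <= n)%N -> ~~ ((x == x') && (y == y')) ->
  compat (linear_coxeter n) (D x y) (D x' y') <-> noncrossing x y x' y'.
Proof.
elim: x y x' y' => [|x IHx] y x' y' xy xy' neq.
  (* When both intervals start at 0, the shorter one must come first for [compat_origin] to apply;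
     otherwise symmetry exchanges them. *)
  have [yy|yy] := boolP ((0 < x') || (y < y'))%N.
    by apply: compat_origin => //; lia.
  have -> : x' = 0%N by lia.
  apply: (iff_trans (compat_sym _ _)); try by apply: almost_positive_eps_diff; lia.
  apply: (iff_trans (compat_origin _ _ _)); try lia.
  by rewrite /noncrossing; split; lia.
case: x' => [|x'] in xy' neq *.
  apply: (iff_trans (compat_sym _ _)); try by apply: almost_positive_eps_diff.
  apply: (iff_trans (compat_origin _ _ _)); try lia.
  by rewrite /noncrossing; split; lia.
case: y y' => [|y] [|y'] // in xy xy' neq *.
by apply: (iff_trans (compat_shift _ _)); try lia; apply: IHx; lia.
Qed.

Lemma compat_opp_simple (i : 'I_n) (b : V) :
  almost_positive b -> b <> - alpha i ->
  compat (linear_coxeter n) (- alpha i) b <-> simple_coef b i = 0.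
Proof.
by have [_ + _] := hcompat (rotated_coxeter 0); rewrite rot0; apply.
Qed.

End Compatibility.

(** * Tubes of the single path *)

Section Tubes.
Variable n : nat.
Local Notation e := (@single_path n).

(* The tube {x+1, ..., y}, as the ordinal i stands for i + 1. *)
Definition interval_tube (x y : nat) : {set pm n} :=
  [set u : pm n | u.2 && (x <= u.1 < y)%N]%SET.

Definition negative_tube (i : 'I_n) : {set pm n} := [set (i, false)]%SET.

Lemma in_interval_tube x y (u : pm n) :
  (u \in interval_tube x y) = u.2 && (x <= u.1 < y)%N.
Proof. by rewrite inE. Qed.

Lemma single_path_sym : symmetric e.
Proof. by move=> u v; rewrite /single_path /= andbCA orbC. Qed.

Lemma tube_interval x y : (x < y <= n)%N -> tube e (interval_tube x y).
Proof.
case/andP=> xy yn; have xn : (x < n)%N by lia.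
apply/and3P; split.
- by apply/set0Pn; exists (Ordinal xn, true); rewrite in_interval_tube /= leqnn.
- set r := (X in connect X).
  have rsym : connect_sym r.
    apply: sym_connect_sym => u v; rewrite /r -[LHS]/[&& _, _ & e u v].
    by rewrite andbCA [e u v]single_path_sym.
  have up d (i j : 'I_n) : j = (i + d)%N :> nat -> (x <= i)%N -> (j < y)%N ->
      connect r (i, true) (j, true).
    elim: d j => [|d IHd] j.
      by rewrite addn0 => /val_inj ->; rewrite connect0.
    move=> ji xi jy; have jn := ltn_ord j; have kn : (i + d < n)%N by lia.
    apply: (connect_trans (IHd (Ordinal kn) _ _ _)) => //=; first by lia.
    apply: connect1; rewrite /r /= !in_interval_tube /=.
    by rewrite /single_path /=; lia.
  apply/forallP => -[i bi]; apply/implyP; rewrite in_interval_tube /= => /andP[-> i1].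
  apply/forallP => -[j bj]; apply/implyP; rewrite in_interval_tube /= => /andP[-> j1].
  have [ij|/ltnW ji] := leqP i j; first by apply: (up (j - i)%N); lia.
  by rewrite rsym; apply: (up (i - j)%N); lia.
- apply/forallP => -[i b]; apply/implyP; rewrite !in_interval_tube /=.
  by case/andP=> -> .
Qed.

Lemma tube_negative i : tube e (negative_tube i).
Proof.
apply/and3P; split.
- by apply/set0Pn; exists (i, false); rewrite inE.
- apply/forallP => u; apply/implyP; rewrite inE => /eqP ->.
  by apply/forallP => v; apply/implyP; rewrite inE => /eqP ->; apply: connect0.
- by apply/forallP => u; apply/implyP; rewrite !inE => /eqP ->; rewrite xpair_eqE andbF.
Qed.

(** Negative vertices are isolated, so a tube containing one is a singleton. Any other tube lies on
    the path, where connectedness rules out gaps between its least and greatest vertex. *)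
Lemma tubeP t : tube e t ->
  (exists x y, (x < y <= n)%N /\ t = interval_tube x y) \/
  exists i, t = negative_tube i.
Proof.
case/and3P => /set0Pn[[i0 b0] i0t] conn _.
set r := (X in connect X) in conn.
have {}conn u v : u \in t -> v \in t -> connect r u v.
  by move=> ut vt; move/forallP/(_ u)/implyP/(_ ut)/forallP/(_ v)/implyP/(_ vt): conn.
have [[i it]|pos] := pselect (exists i, (i, false) \in t).
  right; exists i; apply/setP => v; rewrite inE; apply/idP/eqP => [vt|-> //].
  have /connectP[[|w p]] := conn _ _ it vt; first by [].
  by rewrite /= /r /single_path /= !andbF.
have {}pos u : u \in t -> u.2.
  by case: u => i [] // it; case: pos; exists i.
have b0T := pos _ i0t; rewrite /= in b0T; rewrite b0T in i0t.
pose A k := [exists i : 'I_n, (i == k :> nat) && ((i, true) \in t)].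
have AP (i : 'I_n) : A i = ((i, true) \in t).
  apply/existsP/idP => [[j /andP[/eqP/val_inj -> //]]|it].
  by exists i; rewrite eqxx.
have An k : A k -> (k < n)%N by case/existsP=> i /andP[/eqP <-].
have exA : exists k, A k by exists i0; rewrite AP.
have leA k : A k -> (k <= n)%N by move/An/ltnW.
case: (ex_minnP exA) => x Ax xmin; case: (ex_maxnP exA leA) => y Ay ymax.
left; exists x, y.+1; split; first by rewrite ltnS xmin //= An.
apply/setP => -[k b]; rewrite in_interval_tube /= ltnS.
apply/idP/andP => [kt|[-> xky]].
  have bT := pos _ kt; rewrite /= in bT; rewrite bT in kt *.
  by split=> //; rewrite -AP in kt; rewrite xmin // ymax.
apply: contraT => kt; have kA : ~~ A k by rewrite AP.
(* If [k] were missing from [t], no edge inside [t] could pass from below [k] to above it, although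
   [x] and [y] are connected in [t]. *)
pose below := [pred u : pm n | (u.1 < k)%N].
have cl : closed r below.
  move=> u v /and3P[ut vt]; rewrite /= => /and3P[u2 v2 uv].
  have uk : nat_of_ord u.1 <> k.
    by move=> ek; move: kA; rewrite -ek AP -[true]u2 -surjective_pairing ut.
  have vk : nat_of_ord v.1 <> k.
    by move=> ek; move: kA; rewrite -ek AP -[true]v2 -surjective_pairing vt.
  rewrite !inE /=; move: uv uk vk; clear; move: u.1 v.1 => a b.
  by move: (nat_of_ord a) (nat_of_ord b) (nat_of_ord k) => {}a {}b c; lia.
have xt : (Ordinal (An _ Ax), true) \in t by rewrite -AP.
have yt : (Ordinal (An _ Ay), true) \in t by rewrite -AP.
have := closed_connect cl (conn _ _ xt yt); rewrite !inE /=.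
have : nat_of_ord k <> x by move=> ek; rewrite ek Ax in kA.
by lia.
Qed.

Definition strongly_compatible (s t : {set pm n}) : Prop :=
  weakly_compatible e s t /\ forall u, u \in s -> pm_opp u \notin t.

(** Each tube is strongly compatible with itself, so only distinct pairs matter, as in
    [cluster_fan]. *)
Lemma tubingP (T : set {set pm n}) :
  tubing e T <->
  (forall t, T t -> tube e t) /\
  forall s t, T s -> T t -> s <> t -> strongly_compatible s t.
Proof.
split=> [[tT wT oT]|[tT cT]].
  by split=> // s t sT tT' _; split=> [|u us]; [apply: wT | apply: (oT s)].
have tc s t : T s -> T t -> strongly_compatible s t.
  move=> sT tT'; have [<-|] := eqVneq s t; last by move/eqP; apply: cT.
  split=> [|u us]; first by rewrite /weakly_compatible subxx.
  by have /and3P[_ _ /forallP/(_ u)/implyP/(_ us)] := tT _ sT.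
by split=> // s t; [|move=> u] => sT tT' => [|us]; have [w o] := tc _ _ sT tT'; auto.
Qed.

Lemma weakly_compatible_interval x y x' y' :
  (x < y <= n)%N -> (x' < y' <= n)%N ->
  weakly_compatible e (interval_tube x y) (interval_tube x' y') =
  noncrossing x y x' y'.
Proof.
have sub a b c d : (a < b <= n)%N -> (c < d <= n)%N ->
    (interval_tube a b \subset interval_tube c d) = (c <= a)%N && (b <= d)%N.
  move=> abn cdn; have an : (a < n)%N by lia.
  have bn : (b.-1 < n)%N by lia.
  apply/fintype.subsetP/idP => [h|h u]; last by rewrite !in_interval_tube; lia.
  have := h (Ordinal an, true); have := h (Ordinal bn, true).
  by rewrite !in_interval_tube /=; lia.
move=> xyn xyn'; rewrite /weakly_compatible /noncrossing !sub //.
do 2!congr (_ || _); apply/andP/idP => [[dj ne]|far].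
  have nadj u v : u \in interval_tube x y -> v \in interval_tube x' y' -> ~~ e u v.
    by move=> us vt; move/forallP/(_ u)/implyP/(_ us)/forallP/(_ v)/implyP/(_ vt): ne.
  move/pred0P: dj => dj.
  have xn : (x < n)%N by lia.
  have yn : (y.-1 < n)%N by lia.
  have xn' : (x' < n)%N by lia.
  have yn' : (y'.-1 < n)%N by lia.
  (* Intersecting intervals share the left end of one of them, and adjacent ones are joined by an
     edge from the last vertex of one to the first of the other. *)
  have := dj (Ordinal xn, true); have := dj (Ordinal xn', true).
  have := nadj (Ordinal yn, true) (Ordinal xn', true).
  have := nadj (Ordinal xn, true) (Ordinal yn', true).
  by rewrite /single_path /= !in_interval_tube /=; lia.
split.
  by apply/pred0P => u; rewrite /= !in_interval_tube; lia.
apply/forallP => u; apply/implyP; rewrite in_interval_tube => /andP[_ us].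
apply/forallP => v; apply/implyP; rewrite in_interval_tube => /andP[_ vs].
by rewrite /single_path /=; lia.
Qed.

Lemma strongly_compatible_interval x y x' y' :
  (x < y <= n)%N -> (x' < y' <= n)%N ->
  strongly_compatible (interval_tube x y) (interval_tube x' y') <->
  noncrossing x y x' y'.
Proof.
move=> xyn xyn'; rewrite /strongly_compatible weakly_compatible_interval //.
split=> [[]//|h]; split=> // u.
by rewrite !in_interval_tube => /andP[/= ->].
Qed.

(** The vertex [(i, false)] is isolated and belongs to no other tube, so weak compatibility is
    automatic and only the opposite pair can obstruct. *)
Lemma strongly_compatible_negative i t : tube e t -> t <> negative_tube i ->
  strongly_compatible (negative_tube i) t <-> (i, true) \notin t.
Proof.
move=> tt ti; split=> [[_ /(_ (i, false))]|it]; first by rewrite inE; apply.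
split=> [|u]; last by rewrite inE => /eqP ->.
apply/or3P/Or33/andP; split.
  rewrite disjoints1; apply/negP => it'.
  case/tubeP: tt ti it' => [[x [y [_ ->]]] _|[j -> ji]].
    by rewrite in_interval_tube.
  by rewrite inE => /eqP[ij]; rewrite ij in ji.
apply/forallP => u; apply/implyP; rewrite inE => /eqP ->.
by apply/forallP => v; apply/implyP.
Qed.

Lemma strongly_compatible_sym s t :
  strongly_compatible s t -> strongly_compatible t s.
Proof.
case=> w o; split=> [|u ut]; last first.
  apply/negP => us; have := o _ us; rewrite /pm_opp /= negbK -surjective_pairing.
  by rewrite ut.
case/or3P: w => [h|h|/andP[dj /forallP ne]]; apply/or3P; [exact: Or32|exact: Or31|].
apply/Or33/andP; split; first by rewrite disjoint_sym.
apply/forallP => u; apply/implyP => ut; apply/forallP => v; apply/implyP => vs.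
have /implyP/(_ vs)/forallP/(_ u)/implyP/(_ ut) := ne v.
by rewrite single_path_sym.
Qed.

End Tubes.

(** * The linear isomorphism *)

Section TubeRoots.
Variables (R : realType) (n : nat).
Local Notation V := 'rV[R]_n.+1.
Local Notation alpha := (@simple_root R n).
Local Notation tube := (tube (@single_path n)).

(** The lemmas below show that this is a bijection from tubes to almost positive roots. *)
Definition tube_root (t : {set pm n}) : V := tube_vec R t *m simple_mx R n.

Lemma pm_vec_simple (u : pm n) :
  pm_vec R u *m simple_mx R n = if u.2 then alpha u.1 else - alpha u.1.
Proof.
by rewrite /pm_vec; case: u.2; rewrite ?mulNmx -rowE rowK.
Qed.

Lemma tube_root_interval x y : (x < y <= n)%N ->
  tube_root (interval_tube n x y) = eps_diff R n x y.
Proof.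
move=> xyn; rewrite eps_diff_sum; last by lia.
rewrite /tube_root /tube_vec mulmx_suml.
rewrite (reindex_onto (fun i : 'I_n => (i, true)) (fun u : pm n => u.1)) /=; last first.
  by case=> i b; rewrite in_interval_tube /= => /andP[->].
rewrite big_mkcond; apply: eq_bigr => i _.
rewrite in_interval_tube eqxx andbT /= pm_vec_simple /=.
by case: ifP => _; rewrite ?scale1r ?scale0r.
Qed.

Lemma tube_root_negative i : tube_root (negative_tube i) = - alpha i.
Proof.
by rewrite /tube_root /tube_vec /negative_tube big_set1 pm_vec_simple.
Qed.

Lemma tube_root_almost_positive t : tube t -> almost_positive (tube_root t).
Proof.
case/tubeP=> [[x [y [xyn ->]]]|[i ->]].
  by rewrite tube_root_interval //; apply: almost_positive_eps_diff.
by rewrite tube_root_negative; apply: almost_positive_opp_simple.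
Qed.

Lemma almost_positive_tube_root b : almost_positive b ->
  exists2 t, tube t & b = tube_root t.
Proof.
case/almost_positiveE=> [[x [y [xyn ->]]]|[i ->]].
  by exists (interval_tube n x y); rewrite ?tube_root_interval //; apply: tube_interval.
by exists (negative_tube i); rewrite ?tube_root_negative //; apply: tube_negative.
Qed.

Lemma tube_root_inj s t : tube s -> tube t -> tube_root s = tube_root t -> s = t.
Proof.
case/tubeP=> [[x [y [xyn ->]]]|[i ->]]; case/tubeP=> [[x' [y' [xyn' ->]]]|[j ->]].
- by rewrite !tube_root_interval // => /eps_diff_inj[] // -> ->.
- by rewrite tube_root_interval // tube_root_negative => /eps_diff_neq_opp_simple[].
- rewrite tube_root_interval // tube_root_negative => /esym.
  by move/eps_diff_neq_opp_simple=> [].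
- by rewrite !tube_root_negative => /opp_simple_inj ->.
Qed.

Lemma compat_tube_root compat s t : c_compatibility compat ->
  tube s -> tube t -> s <> t ->
  compat (linear_coxeter n) (tube_root s) (tube_root t) <-> strongly_compatible s t.
Proof.
move=> hcompat ts tt st.
(* The case of a negative tube in first place, from axiom (1): the coefficient at i vanishes exactly
   when i lies outside the interval. Symmetry will cover a negative tube in second place. *)
have neg i u : tube u -> u <> negative_tube i ->
    compat (linear_coxeter n) (tube_root (negative_tube i)) (tube_root u) <->
    strongly_compatible (negative_tube i) u.
  move=> tu ui; have uP := tube_root_almost_positive tu.
  rewrite tube_root_negative; apply: (iff_trans (compat_opp_simple hcompat uP _)).
    by rewrite -tube_root_negative => /(tube_root_inj tu (tube_negative i)).
  apply: iff_trans (iff_sym (strongly_compatible_negative tu ui)).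
  case/tubeP: tu ui {uP} => [[x [y [xyn ->]]]|[j ->]] ui.
    rewrite tube_root_interval // simple_coef_eps_diff; last by lia.
    rewrite in_interval_tube /=; case: (x <= i < y)%N; split=> // /eqP.
    by rewrite oner_eq0.
  rewrite tube_root_negative inE xpair_eqE andbF simple_coef_opp_simple //.
  by apply/eqP => ji; apply: ui; rewrite ji.
case/tubeP: (ts) st => [[x [y [xyn sE]]]|[i ->]] st; last by apply: neg => // /esym.
case/tubeP: (tt) => [[x' [y' [xyn' tE]]]|[i tE]].
  rewrite sE tE !tube_root_interval // in st *.
  apply: iff_trans (iff_sym (strongly_compatible_interval xyn xyn')).
  apply: compat_eps_diff => //; apply/negP => /andP[/eqP xx /eqP yy].
  by apply: st; rewrite xx yy.
have [sP tP] := (tube_root_almost_positive ts, tube_root_almost_positive tt).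
apply: (iff_trans (compat_sym hcompat sP tP)).
rewrite tE in st *; apply: (iff_trans (neg i s ts st)).
by split; apply: strongly_compatible_sym.
Qed.

End TubeRoots.

Lemma image_Cone (R : realType) (vT wT : vectType R) (f : 'Hom(vT, wT)) (A : set vT) :
  [set f v | v in Cone A] = Cone [set f v | v in A].
Proof.
apply/seteqP; split=> [_ [v [k [x [a [xa ->]]]] <-]|v [k [x [a [xa ->]]]]].
  exists k, (fun i => f (x i)), a; split=> [i|].
    by have [Ax a0] := xa i; split=> //; exists (x i).
  by rewrite linear_sum; apply: eq_bigr => i _; rewrite linearZ.
have /choice[z zP] : forall i, exists z, A z /\ f z = x i.
  by move=> i; have [[z Az <-] _] := xa i; exists z.
exists (\sum_(i < k) a i *: z i).
  exists k, z, a; split=> // i; split; first by have [] := zP i.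
  by have [] := xa i.
by rewrite linear_sum; apply: eq_bigr => i _; rewrite linearZ /= (zP i).2.
Qed.

Section LinearMap.
Variables (R : realType) (n : nat).

Definition simple_root_map : 'Hom('rV[R]_n, 'rV[R]_n.+1) :=
  linfun (mulmxr (simple_mx R n)).

Lemma simple_root_mapE v : simple_root_map v = v *m simple_mx R n.
Proof. by rewrite lfunE. Qed.

Lemma simple_root_map_inj : injective simple_root_map.
Proof.
move=> u v; rewrite !simple_root_mapE => /(congr1 (mulmxr (partial_sums_mx R n))).
by rewrite /= -!mulmxA simple_mxK !mulmx1.
Qed.

Lemma simple_root_map_image :
  (simple_root_map @: {: 'rV[R]_n}%VS)%VS = root_space R n.
Proof.
apply/eqP; rewrite eqEsubv; apply/andP; split.
  apply/subvP => _ /memv_imgP[v _ ->]; rewrite simple_root_mapE mul_simple_mx.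
  apply: memv_suml => i _; apply: memvZ; rewrite simple_rootE.
  by apply/memv_span/eps_diff_in_roots; have := ltn_ord i; lia.
(* Positive roots suffice, the remaining ones being their opposites. *)
have mem x y : (x < y <= n)%N -> eps_diff R n x y \in (simple_root_map @: fullv)%VS.
  move=> xyn; apply/memv_imgP.
  exists (\row_(i < n) (x <= i < y)%N%:R); first exact: memvf.
  by rewrite simple_root_mapE -comb_simple -eps_diff_sum //; lia.
apply/span_subvP => _ /mapP[[x y] + ->]; rewrite mem_filter /= => /andP[xy _].
have [xn yn] := (ltn_ord x, ltn_ord y).
rewrite -[x]inord_val -[y]inord_val -/(eps_diff R n x y).
have [lt|lt|/val_inj e] := ltngtP x y; last by rewrite e eqxx in xy.
  by apply: mem; lia.
by rewrite /eps_diff -opprB memvN; apply: mem; lia.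
Qed.

End LinearMap.

Theorem proposition6p1p7 (R : realType) (n : nat) (P : set 'rV[R]_n)
    (compat : {perm 'I_n.+1} -> 'rV[R]_n.+1 -> 'rV[R]_n.+1 -> Prop)
    (hP : standard_cut (@single_path n) P)
    (hcompat : c_compatibility compat) :
  linearly_isomorphic_fans {: 'rV[R]_n}%VS (root_space R n)
    (normal_fan P) (cluster_fan (compat (linear_coxeter n))).
Proof.
rewrite (proj2 hP); exists (simple_root_map R n).
split; [by move=> u v _ _; apply: simple_root_map_inj | exact: simple_root_map_image |].
have img (T : set {set pm n}) :
    [set simple_root_map R n v | v in Cone [set tube_vec R t | t in T]] =
    Cone [set tube_root R t | t in T].
  rewrite image_Cone image_comp; congr (Cone _); apply: eq_imagel => t _ /=.
  by rewrite simple_root_mapE.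
apply/seteqP; split=> [_ [_ [T /tubingP[tT cT] <-] <-]|_ [S [SP Sc] <-]].
  rewrite img; exists [set tube_root R t | t in T] => //.
  split=> [_ [t /tT tt <-]|_ _ [s sT <-] [t tT' <-] st].
    exact: tube_root_almost_positive.
  have {}st : s <> t by move=> e; apply: st; rewrite e.
  by apply/compat_tube_root; auto.
(* The preimage of [S] under [tube_root]; its image is all of [S], since every almost positive root
   comes from a tube. *)
pose T : set {set pm n} := [set t | tube (@single_path n) t /\ S (tube_root R t)].
exists (Cone [set tube_vec R t | t in T]).
  exists T => //; apply/tubingP; split=> [t []//|s t [ts sS] [tt tS] st].
  apply/(compat_tube_root hcompat ts tt st); apply: Sc => //.
  by move/(tube_root_inj ts tt).
rewrite img; congr (Cone _); apply/seteqP; split=> [_ [t [_ tS] <-] //|b bS].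
have [t tt bE] := almost_positive_tube_root (SP _ bS).
by exists t => //; split; rewrite -?bE.
Qed.
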